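(* Let $\alpha,\beta>0$ be rationally independent real numbers, let $p,q\in\mathbb{C}$, and let $f:\mathbb{R}\to\mathbb{C}$ be a measurable function satisfying $$\sum_{k\in\mathbb{Z}} f(x-k\alpha)=p,\qquad \sum_{k\in\mathbb{Z}} f(x-k\beta)=q\qquad\text{for a.e. } x\in\mathbb{R},$$ where both series converge absolutely for a.e. $x$. If the vector $(p,q)$ is not proportional to $(\beta,\alpha)$, then $\operatorname{supp} f$ is an unbounded set.
   Context: Two positive real numbers $\alpha,\beta$ are rationally independent if $n\alpha+m\beta=0$ with $n,m\in\mathbb{Z}$ implies $n=m=0$ (equivalently, $\alpha/\beta$ is irrational). The support of a function $f$ is the set $\operatorname{supp} f=\{x: f(x)\ne 0\}$ (no closure is taken). A vector $u\in\mathbb{C}^2$ is said to be proportional to a vector $v$ if $u=\lambda v$ for some scalar $\lambda\in\mathbb{C}$ (in particular $u=(0,0)$ is proportional to every $v$). *)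

(* Defs.v *)
From mathcomp Require Export all_boot all_order all_algebra.
From mathcomp Require Export complex.
From mathcomp Require Export all_classical all_reals all_analysis.
From mathcomp Require summability.
Export numFieldNormedType.Exports.
Import Order.TTheory GRing.Theory Num.Theory.

Set Implicit Arguments.
Unset Strict Implicit.
Unset Printing Implicit Defensive.

Local Open Scope classical_set_scope.
Local Open Scope ring_scope.

(* R[i]^o (convertible to R[i]) is used wherever the topology of the complex
   plane is needed: the topology given by the modulus is only inferred there. *)

Definition rationally_independent (R : realType) (a b : R) : Prop :=
  forall n m : int, n%:~R * a + m%:~R * b = 0 -> n = 0 /\ m = 0.

Definition proportional (R : realType) (u v : R[i] * R[i]) : Prop :=
  exists lambda : R[i], u = (lambda * v.1, lambda * v.2).

(* R with the sigma-algebra of Lebesgue measurable sets, i.e. the domain of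
   completed_lebesgue_measure; R itself carries the Borel sigma-algebra. *)
Notation lebesgue_line R :=
  (caratheodory_type ((wlength (R := R) idfun)^*)%mu).

(* Preimages of Borel subsets of the complex plane are Lebesgue measurable. *)
Definition lebesgue_measurable (R : realType) (f : R -> R[i]) : Prop :=
  measurable_fun [set: lebesgue_line R]
    (f : lebesgue_line R -> g_sigma_algebraType (@open R[i]^o)).

Definition abs_convergent (R : realType) (u : int -> R[i]) : Prop :=
  esum.summable [set: int] (fun k => (ComplexField.Normc.normc (u k))%:E).

(* Limit of the sums over finite sets of indices, directed by inclusion. *)
Definition has_sum (R : realType) (u : int -> R[i]) (s : R[i]) : Prop :=
  summability.partial_sum u @ summability.totally --> (s : R[i]^o).

Definition supp (R : realType) (f : R -> R[i]) : set R := [set x | f x != 0].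

(* Main.v *)
(* Suppose that supp f is bounded. Taking the real and imaginary parts, we may
   assume that f is real valued, and discarding a null set invariant under the
   translations by alpha and beta, that it is Borel and that both identities
   hold everywhere. The function H x = \sum_(j, k >= 0) f (x - j alpha - k beta)
   is a finite sum at each x, and to the right of supp f it satisfies
   H (x + alpha) = H x + q and H (x + beta) = H x + p. Hence
   D x = H x - (p / beta) x is beta-periodic there, while the translation by
   alpha adds the constant d = q - p alpha / beta to it. A set {|D| <= n}
   occupying 3/4 of each period is disjoint from its translate by m alpha as
   soon as m |d| > 2 n, which is impossible; hence d = 0. *)
Require Import Defs.
From mathcomp Require Import measurable_realfun ring lra.
Import Order.TTheory GRing.Theory Num.Theory.
Local Open Scope classical_set_scope.
Local Open Scope ring_scope.

(** * Translations, null sets and Borel representatives *)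

Lemma measurable_shift (R : realType) (c : R) (A : set R) :
  measurable A -> measurable [set x | A (x + c)].
Proof.
move=> mA; rewrite -[X in measurable X]setTI.
suff h : measurable_fun [set: R] (fun x : R => x + c) by exact: h.
exact: measurable_funD.
Qed.

(** The pushforward of the measure under the translation has the same values on half-open intervals,
    so uniqueness applies. *)
Lemma lebesgue_measure_shift (R : realType) (c : R) (A : set R) :
  measurable A ->
  lebesgue_measure [set x | A (x + c)] = lebesgue_measure A.
Proof.
move=> mA.
have mc : measurable_fun [set: measurableTypeR R]
    (fun x : measurableTypeR R => x + c : measurableTypeR R).
  exact: measurable_funD.
(* The instance is named because its measurability hypothesis on the map is not
   inferred. *)
pose nu : {measure set (measurableTypeR R) -> \bar R} :=
  measure_function_pushforward__canonical__measure_function_Measure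
    lebesgue_measure mc.
rewrite [RHS](@lebesgue_measure_unique R nu) //.
move=> X [[x y] /= xy <-].
rewrite /nu/= /pushforward/=.
rewrite (_ : _ @^-1` _ = `]x - c, y - c]%classic); last first.
  by apply/seteqP; split=> t /=; rewrite !in_itv/= ltrBlDr lerBrDr.
by rewrite !lebesgue_measure_itv/= !lte_fin ltrD2r -!EFinB opprB addrA subrK.
Qed.

Lemma null_bigcup (R : realType) (I : countType) (F : I -> set R) :
  (forall i, measurable (F i) /\ lebesgue_measure (F i) = 0%E) ->
  measurable (\bigcup_i F i) /\ lebesgue_measure (\bigcup_i F i) = 0%E.
Proof.
move=> F0; have mF : measurable (\bigcup_i F i).
  by apply: countable_bigcupT_measurable => // i; case: (F0 i).
split=> //; apply: measure_negligible => //.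
(* The family is reindexed by the codes of [I], with the empty set at numbers that code nothing. *)
pose G n := if unpickle n is Some i then F i else set0.
suff : lebesgue_measure.-negligible (\bigcup_n G n).
  apply: negligibleS.
  by move=> x [i _ Fx]; exists (pickle i); rewrite // /G pickleK.
apply: negligible_bigcup => n; rewrite /G.
case: unpickle => [i|]; last exact: negligible_set0.
by apply/negligibleP; case: (F0 i).
Qed.

(** Each set {g > r} with r rational is Borel up to a subset of a Borel null set. These null sets
    are countably many, and [Z] is their union. *)
Lemma measurable_off_null (R : realType) (g : R -> R) :
  measurable_fun [set: lebesgue_line R] (g : lebesgue_line R -> R) ->
  exists Z : set R, [/\ measurable Z, lebesgue_measure Z = 0%E &
    measurable_fun (~` Z) g].
Proof.
move=> mg.
have AB (r : rat) : exists A B : set R, [/\ measurable A, measurable B,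
    lebesgue_measure B = 0%E & forall x, ~ B x -> A x <-> ratr r < g x].
  have : (completed_algebra_gen (@lebesgue_measure R)).-sigma.-measurable
      (g @^-1` `]ratr r, +oo[).
    rewrite completed_caratheodory_measurable -[X in _ X]setTI.
    exact: (mg measurableT _ (measurable_itv _)).
  rewrite g_sigma_completed_algebra_genE => -[A mA [N [B [mB B0 NB]]] ANE].
  exists A, B; split=> // x Bx.
  have gE : (A `|` N) x <-> ratr r < g x by rewrite ANE /= in_itv/= andbT.
  by split=> [Ax|/gE [//|/NB //]]; apply/gE; left.
have [A /choice [B ABr]] := choice AB.
have gA r x : ~ B r x -> A r x <-> ratr r < g x.
  by case: (ABr r) => _ _ _; apply.
have [|mZ Z0] := @null_bigcup R _ B.
  by move=> r; case: (ABr r).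
exists (\bigcup_r B r); split=> //.
apply: (measurability _ (RGenOInfty.measurableE R)) => _ [_ [r ->] <-].
(* For a real level r, {g > r} is the union of the sets {g > s} over the rationals s > r. *)
rewrite (_ : _ `&` _ = ~` (\bigcup_r B r) `&`
    \bigcup_(s in [set s : rat | r < ratr s]) A s).
  apply: measurableI; first exact: measurableC.
  rewrite bigcup_mkcond; apply: bigcupT_measurable_rat => s.
  by case: ifP => // _; case: (ABr s).
apply/seteqP; split=> x [Zx].
  rewrite /= in_itv/= andbT => rgx; split=> //.
  have [s] := rat_in_itvoo rgx; rewrite in_itv/= => /andP[rs sg].
  by exists s => //; apply/gA => // Bx; apply: Zx; exists s.
move=> [s /= rs Asx]; split=> //; rewrite /= in_itv/= andbT.
by apply: lt_trans rs _; apply/gA => // Bx; apply: Zx; exists s.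
Qed.

(** [Z] is the union of the translates of a null Borel cover of [N] by all integer combinations of
    [a] and [b]; there are countably many, and these translations permute them. *)
Lemma null_invariant_hull (R : realType) (a b : R) (N : set R) :
  lebesgue_measure.-negligible N ->
  exists Z : set R, [/\ measurable Z, lebesgue_measure Z = 0%E, N `<=` Z &
    forall x (i j : int), Z (x + i%:~R * a + j%:~R * b) -> Z x].
Proof.
move=> [B [mB B0 NB]].
pose F (ij : int * int) := [set x | B (x + (ij.1%:~R * a + ij.2%:~R * b))].
have [|mZ Z0] := @null_bigcup R _ F.
  move=> ij; rewrite /F lebesgue_measure_shift //; split=> //.
  exact: measurable_shift.
exists (\bigcup_ij F ij); split=> //.
  by move=> x /NB Bx; exists (0, 0) => //; rewrite /F /= !mul0r !addr0.
move=> x i j [[k l] _]; rewrite /F /= => h; exists (i + k, j + l) => //=.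
by rewrite !intrD !mulrDl addrACA !addrA in h *.
Qed.

(** * Measurable functions with a period and a drift *)

Lemma measurable_sublevel_off (R : realType) (Z : set R) (D : R -> R) (c : R) :
  measurable Z -> measurable_fun [set: R] D ->
  measurable [set x | ~ Z x /\ `|D x| <= c].
Proof.
move=> mZ mD; apply: measurableI; first exact: measurableC.
rewrite -[X in measurable X]setTI.
by apply: measurable_fun_le => //; exact: measurableT_comp.
Qed.

(** The level sets increase with n to the interval minus [Z], of measure [b], so continuity from
    below applies. The fraction 3/4 could be any number strictly between 1/2 and 1. *)
Lemma level_set_large (R : realType) (M b : R) (Z : set R) (D : R -> R) :
  0 < b -> measurable Z -> lebesgue_measure Z = 0%E ->
  measurable_fun [set: R] D ->
  exists n : nat, ((3 / 4 * b)%:E <=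
    lebesgue_measure
      ([set x | ~ Z x /\ (`|D x| <= n%:R)%R] `&` `]M, (M + b)%R]))%E.
Proof.
move=> b0 mZ Z0 mD.
pose A (n : nat) := [set x | ~ Z x /\ `|D x| <= n%:R] `&` `]M, (M + b)].
have mA n : measurable (A n).
  by apply: measurableI => //; exact: measurable_sublevel_off.
have UA : \bigcup_n A n = `]M, (M + b)] `\` Z.
  apply/seteqP; split=> [x [n _ [[Zx _] ?]] //|x [xM Zx]].
  by have /ltW := truncnS_gt `|D x|; exists (Num.truncn `|D x|).+1.
have mUA : measurable (\bigcup_n A n) by exact: bigcupT_measurable.
have ndA : nondecreasing_seq A.
  move=> m n mn; apply/subsetPset => x [[Zx Dx] Mx]; split=> //; split=> //.
  by apply: le_trans Dx _; rewrite ler_nat.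
have muI : lebesgue_measure (`]M, (M + b)] : set R) = b%:E.
  by rewrite lebesgue_measure_itv/= lte_fin ltrDl b0 -EFinB addrAC subrr add0r.
have muUA : lebesgue_measure (\bigcup_n A n) = b%:E.
  rewrite UA measureD //; last by rewrite /= muI ltry.
  rewrite /= muI [X in (_ - X)%E](_ : _ = 0%E) ?sube0 //.
  apply: measure_negligible; first exact: measurableI.
  by apply: (negligibleS (@subIsetr _ _ _)); exact/negligibleP.
have cvgA : lebesgue_measure (A n) @[n --> \oo] --> b%:E.
  by rewrite -muUA; exact: nondecreasing_cvg_mu.
have /cvgA : nbhs b%:E [set y | ((3 / 4 * b)%:E < y)%E].
  apply: open_nbhs_nbhs; split; first exact: open_ereal_gt_ereal.
  by rewrite /= lte_fin; lra.
move=> [n _ /(_ n (leqnn n))] /= /ltW; by exists n.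
Qed.

(** One period may be shorter than the translation by [m * a], so the level set is taken over [J]
    periods, with [m * a] less than half their total length. The set and its translate then cannot
    be disjoint. *)
Lemma no_measurable_drift (R : realType) (a b d M : R) (Z : set R)
    (D : R -> R) :
  0 < a -> 0 < b -> measurable Z -> lebesgue_measure Z = 0%E ->
  (forall x, ~ Z x -> ~ Z (x + a) /\ ~ Z (x + b)) ->
  measurable_fun [set: R] D ->
  (forall x, M < x -> ~ Z x -> D (x + b) = D x) ->
  (forall x, M < x -> ~ Z x -> D (x + a) = D x + d) ->
  d = 0.
Proof.
move=> a0 b0 mZ Z0 Zab mD Db Da; apply/eqP/negP => /negP d0.
have [n An] := level_set_large R M b Z D b0 mZ Z0 mD.
set E := [set x | _] in An.
have mE : measurable E by exact: measurable_sublevel_off.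
have DbJ J x : M < x -> ~ Z x ->
    [/\ M < x + J%:R * b, ~ Z (x + J%:R * b) & D (x + J%:R * b) = D x].
  move=> Mx Zx; elim: J => [|J [MJ ZJ DJ]]; first by rewrite mul0r addr0.
  have -> : x + J.+1%:R * b = x + J%:R * b + b by rewrite -natr1; ring.
  split; [lra|by case: (Zab _ ZJ)|by rewrite Db].
have DaJ J x : M < x -> ~ Z x ->
    [/\ M < x + J%:R * a, ~ Z (x + J%:R * a)
      & D (x + J%:R * a) = D x + J%:R * d].
  move=> Mx Zx; elim: J => [|J [MJ ZJ DJ]]; first by rewrite !mul0r !addr0.
  have -> : x + J.+1%:R * a = x + J%:R * a + a by rewrite -natr1; ring.
  split; [lra|by case: (Zab _ ZJ)|by rewrite Da // DJ -natr1; ring].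
have EJ (J : nat) : ((J%:R * (3 / 4 * b))%:E <=
    lebesgue_measure (E `&` `]M, (M + J%:R * b)%R]))%E.
  elim: J => [|J IH]; first by rewrite mul0r measure_ge0.
  (* The part of [E] in the first period, moved into the last of the [J.+1] periods; it stays in [E]
     since [D] is periodic there. *)
  pose A' := [set x | (E `&` `]M, (M + b)%R]) (x + - (J%:R * b))].
  have mA' : measurable A' by apply: measurable_shift; exact: measurableI.
  have muA' : ((3 / 4 * b)%:E <= lebesgue_measure A')%E.
    by rewrite lebesgue_measure_shift //; exact: measurableI.
  apply: (@le_trans _ _ (lebesgue_measure
    ((E `&` `]M, (M + J%:R * b)%R]) `|` A'))).
    rewrite measureU //; first last.
    - apply/seteqP; split=> x //= -[[_]]; rewrite /A' /= !in_itv /=.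
      by move=> /andP[_ ?] [_ /andP[? _]]; lra.
    - exact: measurableI.
    rewrite -natr1 mulrDl mul1r EFinD; exact: leeD.
  have JbS : J.+1%:R * b = J%:R * b + b by rewrite -natr1; ring.
  have Jb0 : 0 <= J%:R * b by rewrite mulr_ge0 // ltW.
  apply: le_measure; rewrite ?inE.
  - by apply: measurableU => //; exact: measurableI.
  - exact: measurableI.
  move=> x [[Ex]|]; rewrite /= /A' /= !in_itv/=.
    move=> /andP[? ?]; split=> //; apply/andP; split; lra.
  move=> [[Zx Dx]] /andP[x1 x2].
  have [x3 x4 x5] := DbJ J _ x1 Zx.
  rewrite !subrK in x3 x4 x5.
  by split; [split=> //; rewrite x5|apply/andP; split; lra].
(* After [m] steps the drift exceeds 2n, the largest difference of two values of [D] on [E]. *)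
have [m dm] : exists m : nat, 2 * n%:R < m%:R * `|d|.
  exists (Num.truncn (2 * n%:R / `|d|)).+1.
  by rewrite -ltr_pdivrMr ?normr_gt0 // truncnS_gt.
have [J Jm] : exists J : nat, m%:R * a < J%:R * (b / 2).
  exists (Num.truncn (m%:R * a / (b / 2))).+1.
  by rewrite -ltr_pdivrMr ?truncnS_gt //; lra.
have ma0 : 0 <= m%:R * a by rewrite mulr_ge0 // ltW.
have Jb0 : 0 <= J%:R * b by rewrite mulr_ge0 // ltW.
pose B := E `&` `]M, (M + J%:R * b)%R].
have mB : measurable B by exact: measurableI.
pose B' := [set x | B (x + - (m%:R * a))].
have mB' : measurable B' by exact: measurable_shift.
have BB' : B `&` B' = set0.
  apply/seteqP; split=> x //= -[[[Zx Dx] _]]; rewrite /B' /B /= in_itv /=.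
  move=> [[Zx' Dx'] /andP[x1 _]].
  have [_ _] := DaJ m _ x1 Zx'; rewrite subrK => DE.
  have : `|m%:R * d| <= n%:R + n%:R.
    rewrite (_ : m%:R * d = D x - D (x - m%:R * a)); last by rewrite DE; ring.
    by apply: le_trans (ler_normB _ _) _; exact: lerD.
  by rewrite normrM normr_nat; lra.
have : (lebesgue_measure (B `|` B') <= (J%:R * b + m%:R * a)%:E)%E.
  apply: (@le_trans _ _ (lebesgue_measure `]M, (M + J%:R * b + m%:R * a)%R])).
    apply: le_measure; rewrite ?inE //; first exact: measurableU.
    move=> x [[_]|[_]]; rewrite /= !in_itv /= => /andP[? ?].
      by apply/andP; split; lra.
    by apply/andP; split; lra.
  rewrite lebesgue_measure_itv/= lte_fin; case: ifPn => _.
    by rewrite -EFinB lee_fin; lra.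
  by rewrite lee_fin addr_ge0.
rewrite measureU // [X in (_ + X)%E]lebesgue_measure_shift // => le1.
have := le_trans (leeD (EJ J) (EJ J)) le1.
(* Two disjoint sets of measure at least 3/4 of [J * b] would fit in length [J * b + m * a], which
   is less than 3/2 of [J * b]. *)
rewrite -EFinD lee_fin; lra.
Qed.

(** * Double sums of translates and the relation between the two levels *)

Lemma sum_ord_tail0 (V : nmodType) (F : nat -> V) (m n : nat) :
  (m <= n)%N -> (forall i, (m <= i)%N -> F i = 0) ->
  \sum_(i < n) F i = \sum_(i < m) F i.
Proof.
move=> mn F0; rewrite -!(big_mkord predT F) (big_cat_nat _ mn) //=.
rewrite [X in _ + X]big_nat_cond [X in _ + X]big1 ?addr0 //.
by move=> i /andP[/andP[/F0]].
Qed.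

(** Truncation of [H]; the common bound on both indices makes it symmetric in [a] and [b]. *)
Definition double_sum (R : realType) (g : R -> R) (a b : R) (n : nat) (x : R) :=
  \sum_(j < n) \sum_(k < n) g (x - j%:R * a - k%:R * b).

Lemma double_sumC (R : realType) (g : R -> R) (a b : R) (n : nat) (x : R) :
  double_sum R g a b n x = double_sum R g b a n x.
Proof.
rewrite /double_sum exchange_big; apply: eq_bigr => k _; apply: eq_bigr => j _.
by congr g; ring.
Qed.

(** A term with an index at least N lies to the left of [m] once both [N * a] and [N * b] exceed
    [x - m]. *)
Lemma double_sum_stationary (R : realType) (g : R -> R) (a b m : R) :
  0 < a -> 0 < b -> (forall x, x < m -> g x = 0) ->
  forall x, exists l, \forall n \near \oo, double_sum R g a b n x = l.
Proof.
move=> a0 b0 g0 x.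
have [N [Na Nb]] : exists N : nat, x - m < N%:R * a /\ x - m < N%:R * b.
  have [Na Nb] := (truncnS_gt ((x - m) / a), truncnS_gt ((x - m) / b)).
  exists (maxn (Num.truncn ((x - m) / a)).+1 (Num.truncn ((x - m) / b)).+1).
  rewrite -!ltr_pdivrMr //; split.
    by apply: lt_le_trans Na _; rewrite ler_nat leq_maxl.
  by apply: lt_le_trans Nb _; rewrite ler_nat leq_maxr.
exists (double_sum R g a b N x); exists N => // n /= Nn.
have gN c d (i k : nat) : 0 < c -> 0 < d -> x - m < N%:R * c -> (N <= i)%N ->
    g (x - i%:R * c - k%:R * d) = 0.
  move=> c0 d0 Nc Ni; apply: g0.
  have : 0 <= k%:R * d by rewrite mulr_ge0 // ltW.
  have : N%:R * c <= i%:R * c by rewrite ler_pM2r // ler_nat.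
  lra.
rewrite /double_sum (sum_ord_tail0 _
  (fun j => \sum_(k < n) g (x - j%:R * a - k%:R * b)) _ _ Nn); last first.
  by move=> j Nj; rewrite big1 // => k _; exact: gN.
apply: eq_bigr => j _.
apply: (sum_ord_tail0 _ (fun k => g (x - j%:R * a - k%:R * b)) _ _ Nn) => k Nk.
by rewrite addrAC; exact: gN.
Qed.

(** Moving [x] by [a] shifts the rows by one: the new first row sums to [q], and the row lost at the
    end lies to the left of [m]. *)
Lemma double_sum_shift (R : realType) (g : R -> R) (a b m q x : R) :
  0 < a -> 0 < b -> (forall x, x < m -> g x = 0) ->
  (forall n : nat, x + a - n%:R * b < m ->
     \sum_(k < n) g (x + a - k%:R * b) = q) ->
  \forall n \near \oo,
    double_sum R g a b n (x + a) = double_sum R g a b n x + q.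
Proof.
move=> a0 b0 g0 gq.
(* The outer successor makes the truncation [n.+1], whose last row has index [n], with [n * a]
   already beyond [x - m]. *)
exists (maxn (Num.truncn ((x - m) / a)).+1
             (Num.truncn ((x + a - m) / b)).+1).+1 => //.
move=> [//|n] /=; rewrite ltnS geq_max => /andP[na nb].
have {na} na : x - m < n%:R * a.
  rewrite -ltr_pdivrMr //.
  by apply: lt_le_trans (truncnS_gt _) _; rewrite ler_nat.
have {nb} nb : x + a - m < n%:R * b.
  rewrite -ltr_pdivrMr //.
  by apply: lt_le_trans (truncnS_gt _) _; rewrite ler_nat.
rewrite /double_sum big_ord_recl [in RHS]big_ord_recr /= !mul0r !subr0.
rewrite gq; last by rewrite -natr1 mulrDl; lra.
rewrite [X in _ + X + _]big1 ?addr0; last first.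
  move=> k _; apply: g0.
  have : 0 <= k%:R * b by rewrite mulr_ge0 // ltW.
  lra.
rewrite addrC; congr (_ + _); apply: eq_bigr => j _; apply: eq_bigr => k _.
by congr g; rewrite /bump /= add1n -natr1; ring.
Qed.

(** To the right of a bounded support, a sum over all integers reduces to the indices [k < n] as
    soon as the n-th translate passes [m]; the two sum hypotheses have this finite form. *)
Lemma levels_proportional (R : realType) (g : R -> R) (a b p q m M : R)
    (Z : set R) :
  0 < a -> 0 < b -> measurable Z -> lebesgue_measure Z = 0%E ->
  (forall x, ~ Z x -> ~ Z (x + a) /\ ~ Z (x + b)) ->
  measurable_fun [set: R] g ->
  (forall x, x < m -> g x = 0) ->
  (forall x (n : nat), M < x -> ~ Z x -> x - n%:R * a < m ->
     \sum_(k < n) g (x - k%:R * a) = p) ->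
  (forall x (n : nat), M < x -> ~ Z x -> x - n%:R * b < m ->
     \sum_(k < n) g (x - k%:R * b) = q) ->
  p * a = q * b.
Proof.
move=> a0 b0 mZ Z0 Zab mg g0 ga gb.
have [H HE] := choice (double_sum_stationary R g a b m a0 b0 g0).
have mH : measurable_fun [set: R] H.
  apply: (measurable_fun_cvg (h := double_sum R g a b)).
    move=> n; rewrite /double_sum; apply: measurable_sum => j.
    apply: measurable_sum => k; apply: measurableT_comp => //.
    by apply: measurable_funB => //; exact: measurable_funB.
  by move=> x _; apply: cvg_near_cst; exact: HE.
have Ha x : M < x -> ~ Z x -> H (x + a) = H x + q.
  move=> Mx Zx; have [Zxa _] := Zab _ Zx.
  have := double_sum_shift R g a b m q x a0 b0 g0.
  case: {HE}(HE x) (HE (x + a)) => N1 _ H1 [N2 _ H2] [|N3 _ H3].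
    by move=> n; apply: gb => //; lra.
  pose n := maxn N1 (maxn N2 N3).
  rewrite -(H1 n) /= ?leq_maxl // -(H2 n) /= ?H3 //=;
    by rewrite /n !leq_max leqnn ?orbT.
have Hb x : M < x -> ~ Z x -> H (x + b) = H x + p.
  move=> Mx Zx; have [_ Zxb] := Zab _ Zx.
  have := double_sum_shift R g b a m p x b0 a0 g0.
  case: {HE}(HE x) (HE (x + b)) => N1 _ H1 [N2 _ H2] [|N3 _ H3].
    by move=> n; apply: ga => //; lra.
  pose n := maxn N1 (maxn N2 N3).
  rewrite -(H1 n) /= ?leq_maxl // -(H2 n) /=;
    rewrite 1?double_sumC ?H3 1?double_sumC //=;
    by rewrite /n !leq_max leqnn ?orbT.
(* Subtracting the linear function of slope [p / b] cancels the increment of [H] along [b]. *)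
have : q - p / b * a = 0.
  apply: (no_measurable_drift R a b _ M Z (fun x => H x - p / b * x)) => //.
  - by apply: measurable_funB => //; exact: measurable_funM.
  - by move=> x Mx Zx; rewrite Hb //; field; rewrite gt_eqF.
  - by move=> x Mx Zx; rewrite Ha //; ring.
move/eqP; rewrite subr_eq0 => /eqP ->.
by field; rewrite gt_eqF.
Qed.

(** [g] is set to 0 on an invariant null set containing all exceptional points. By invariance, no
    term of the sums at a point outside that set changes. *)
Lemma levels_proportional_ae (R : realType) (g : R -> R) (a b p q m M : R) :
  0 < a -> 0 < b ->
  measurable_fun [set: lebesgue_line R] (g : lebesgue_line R -> R) ->
  (forall x, x < m -> g x = 0) ->
  {ae (@lebesgue_measure R), forall x, forall n : nat, M < x ->
     x - n%:R * a < m -> \sum_(k < n) g (x - k%:R * a) = p} ->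
  {ae (@lebesgue_measure R), forall x, forall n : nat, M < x ->
     x - n%:R * b < m -> \sum_(k < n) g (x - k%:R * b) = q} ->
  p * a = q * b.
Proof.
move=> a0 b0 mg g0 ga gb.
have [Z1 [mZ1 Z10 mg1]] := measurable_off_null R g mg.
have nZ1 : lebesgue_measure.-negligible Z1 by exact/negligibleP.
have [Z [mZ Z0 NZ Zinv]] := null_invariant_hull R a b _
  (negligibleU nZ1 (negligibleU ga gb)).
have Zsub x (k : nat) : ~ Z x -> ~ Z (x - k%:R * a) /\ ~ Z (x - k%:R * b).
  move=> Zx; split=> [Zxa|Zxb]; apply: Zx.
    apply: (Zinv x (- k%:Z) 0); rewrite mul0r addr0 intrN mulNr; exact: Zxa.
  by apply: (Zinv x 0 (- k%:Z)); rewrite mul0r addr0 intrN mulNr; exact: Zxb.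
have gZ x : ~ Z x -> (g \_ (~` Z)) x = g x.
  by move=> Zx; rewrite patchE mem_set.
apply: (levels_proportional R (g \_ (~` Z)) a b p q m M Z) => //.
- move=> x Zx; split=> Zx'; apply: Zx.
    by apply: (Zinv x 1 0); rewrite mul1r mul0r addr0.
  by apply: (Zinv x 0 1); rewrite mul1r mul0r addr0.
- apply/(measurable_restrictT _ (measurableC mZ)).
  apply: measurable_funS mg1; first exact: measurableC.
  by apply: subsetC => x Z1x; apply: NZ; left.
- by move=> x xm; rewrite patchE g0 // if_same.
- move=> x n Mx Zx xn.
  rewrite (eq_bigr (fun k : 'I_n => g (x - k%:R * a))); last first.
    by move=> k _; rewrite gZ //; case: (Zsub x k Zx).
  by apply: contrapT => h; apply/Zx/NZ; right; left => /(_ n Mx xn).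
- move=> x n Mx Zx xn.
  rewrite (eq_bigr (fun k : 'I_n => g (x - k%:R * b))); last first.
    by move=> k _; rewrite gZ //; case: (Zsub x k Zx).
  by apply: contrapT => h; apply/Zx/NZ; right; right => /(_ n Mx xn).
Qed.

(* From complex unordered sums to finite real sums *)
(* Imported only here: finmap shadows [unpickle] and [inE]. *)
From mathcomp Require Import finmap.

(** The partial sums are constant over all finite sets containing 0, ..., n - 1, and limits are
    unique. *)
Lemma has_sum_finite (R : realType) (u : int -> R[i]) (s : R[i]) (n : nat) :
  (forall k : int, u k != 0 -> exists2 i : nat, (i < n)%N & k = i) ->
  has_sum u s -> \sum_(i < n) u i = s.
Proof.
move=> u0 us; have FF := @summability.totally_filter int.
apply/esym/(@cvg_unique _ (@norm_hausdorff _ R[i]^o) _ _ _ _ us).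
apply: cvg_near_cst.
have [S permS] : exists S : {fset int}, perm_eq S [seq Posz i | i <- iota 0 n].
  exists (seq_fset tt [seq Posz i | i <- iota 0 n]).
  apply: perm_trans (seq_fset_perm _ _) _; rewrite undup_id //.
  by rewrite map_inj_uniq ?iota_uniq // => i j [].
exists S => // A /= SA.
rewrite /summability.partial_sum -(big_seq_fsetE _ _ predT) /=.
rewrite -(big_fset_incl _ SA) /=; last first.
  move=> k _; rewrite (perm_mem permS); apply: contraNeq => /u0 [i ilt ->].
  by apply: map_f; rewrite mem_iota.
by rewrite (perm_big _ permS) /= big_map -{1}(subn0 n) big_mkord.
Qed.

Lemma continuous_real_functional (R : realType) (phi : R[i] -> R) :
  {morph phi : x y / x - y} -> (forall z, (`|phi z|%:C)%C <= `|z|) ->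
  continuous (phi : R[i]^o -> R).
Proof.
move=> phiB phi_le z.
have FF : Filter (nbhs (z : R[i]^o)) by exact: nbhs_filter.
apply: (proj2 (@cvgrPdist_lt _ _ _ _ FF _ _)) => e e0.
(* The norm of [R[i]] takes values in [R[i]], so the radius is embedded there. *)
apply/nbhs_ballP; exists (e%:C)%C => /=; first by rewrite ltcR.
move=> y; rewrite -ball_normE /= => zy.
by rewrite -phiB -ltcR; apply: le_lt_trans (phi_le _) zy.
Qed.

Lemma measurable_real_functional (R : realType) (phi : R[i] -> R) :
  {morph phi : x y / x - y} -> (forall z, (`|phi z|%:C)%C <= `|z|) ->
  measurable_fun [set: g_sigma_algebraType (@open R[i]^o)]
    (phi : g_sigma_algebraType (@open R[i]^o) -> R).
Proof.
move=> phiB phi_le.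
apply: (measurability _ (RGenOpens.measurableE R)) => _ [_ [x [y ->]] <-].
rewrite setTI; apply: sub_sigma_algebra.
have /continuousP := continuous_real_functional R phi phiB phi_le.
apply; exact: interval_open.
Qed.

(** An additive [phi] bounded by the modulus covers the real and the imaginary part at once. *)
Lemma levels_proportional_functional (R : realType) (phi : R[i] -> R)
    (f : R -> R[i]) (a b M : R) (p q : R[i]) :
  {morph phi : x y / x - y} -> (forall z, (`|phi z|%:C)%C <= `|z|) ->
  0 < a -> 0 < b -> lebesgue_measurable f ->
  (forall x, f x != 0 -> `|x| <= M) ->
  {ae (@lebesgue_measure R), forall x : R,
     has_sum (fun k : int => f (x - k%:~R * a)) p} ->
  {ae (@lebesgue_measure R), forall x : R,
     has_sum (fun k : int => f (x - k%:~R * b)) q} ->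
  phi p * a = phi q * b.
Proof.
move=> phiB phi_le a0 b0 mf fM sa sb.
have phi0 : phi 0 = 0 by rewrite -(subrr 0) phiB subrr.
have phiD : {morph phi : x y / x + y}.
  by move=> x y; rewrite -{1}(opprK y) phiB -(sub0r y) phiB phi0 sub0r opprK.
have fsum c (r : R[i]) : 0 < c ->
    {ae (@lebesgue_measure R), forall x : R,
     has_sum (fun k : int => f (x - k%:~R * c)) r} ->
    {ae (@lebesgue_measure R), forall x, forall n : nat, M < x ->
     x - n%:R * c < - M -> \sum_(k < n) (phi \o f) (x - k%:R * c) = phi r}.
  move=> c0; apply: negligibleS => x h xr; apply: h => n Mx xn.
  rewrite -(has_sum_finite _ _ _ n _ xr) ?(big_morph phi phiD phi0) //.
  (* A nonzero term has [x - k * c] between [-M] and [M]; with [M < x] and [x - n * c < -M] this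
     forces 0 < k < n. *)
  move=> k /fM; rewrite ler_norml => /andP[Mk kM].
  have k0 : 0 < k%:~R * c by lra.
  have kn : k%:~R * c < n%:R * c by lra.
  move: k0 kn; rewrite pmulr_lgt0 // ltr_pM2r // ltr0z -[n%:R]/(n%:~R) ltr_int.
  by case: k {Mk kM} => // i _ ?; exists i.
have mphif := measurableT_comp
  (measurable_real_functional R phi phiB phi_le) mf.
have phif0 x : x < - M -> (phi \o f) x = 0.
  move=> xM /=; case: (eqVneq (f x) 0) => [-> //|/fM].
  by rewrite ler_norml => /andP[]; lra.
exact: (levels_proportional_ae R (phi \o f) a b (phi p) (phi q) (- M) M
  a0 b0 mphif phif0 (fsum a p a0 sa) (fsum b q b0 sb)).
Qed.

Theorem theorem2p2 (R : realType) (alpha beta : R) (p q : R[i]) (f : R -> R[i])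
  (alpha_gt0 : 0 < alpha) (beta_gt0 : 0 < beta)
  (indep : rationally_independent alpha beta)
  (mf : lebesgue_measurable f)
  (abs_alpha : {ae (@lebesgue_measure R), forall x : R,
     abs_convergent (fun k : int => f (x - k%:~R * alpha))})
  (abs_beta : {ae (@lebesgue_measure R), forall x : R,
     abs_convergent (fun k : int => f (x - k%:~R * beta))})
  (sum_alpha : {ae (@lebesgue_measure R), forall x : R,
     has_sum (fun k : int => f (x - k%:~R * alpha)) p})
  (sum_beta : {ae (@lebesgue_measure R), forall x : R,
     has_sum (fun k : int => f (x - k%:~R * beta)) q})
  (nprop : ~ proportional (p, q) (beta%:C, alpha%:C)%C) :
  ~ bounded_set (supp f).
Proof.
move=> [M0 [_ bM]]; apply: nprop.
(* Boundedness provides only the bounds strictly above [M0]. *)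
have fM x : f x != 0 -> `|x| <= M0 + 1 by apply: bM; rewrite ltrDl.
have reE := levels_proportional_functional R (@complex.Re R) f alpha beta _ p q
  (raddfB (@complex.Re R : Rcomplex R -> R)) (@normc_ge_Re R)
  alpha_gt0 beta_gt0 mf fM sum_alpha sum_beta.
(* The imaginary part of z is minus the real part of iz, and i has modulus 1. *)
have Im_le (z : R[i]) : (`|complex.Im z|%:C)%C <= `|z|.
  have := normc_ge_Re (z * 'i%C); rewrite ReiNIm normrN normrM.
  by rewrite (normc_def 'i%C) /= expr0n expr1n add0r sqrtr1 mulr1.
have imE := levels_proportional_functional R (@complex.Im R) f alpha beta _ p q
  (raddfB (@complex.Im R : Rcomplex R -> R)) Im_le
  alpha_gt0 beta_gt0 mf fM sum_alpha sum_beta.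
(* The factor p / beta is forced by the first coordinate; the second follows from p alpha = q beta,
   known for both parts. *)
exists ((beta^-1)%:C%C * p); congr pair => /=.
  by rewrite mulrAC -rmorphM /= mulVf ?mul1r // gt_eqF.
case: p q reE imE {sum_alpha sum_beta} => [p1 p2] [q1 q2] /= reE imE.
by simpc; rewrite -!mulrA reE imE !(mulrCA beta^-1) mulVf ?mulr1 // gt_eqF.
Qed.
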